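(* Let $\mathbb{T}$ be the Tribonacci sequence and, for $n\ge1$, let $A(n)$ be the number of distinct nonempty words $\omega$ such that $\omega\omega$ is a factor of $\mathbb{T}[1,n]$. Then $A(n)=0$ for $n\leq7$; $A(n)=1$ for $n=8,9$; $A(n)=2$ for $10\leq n\leq13$. For $n\geq14$, let $m$ be such that $\alpha_m\leq n<\alpha_{m+1}$; then $m\geq4$ and \begin{equation*} A(n)= \begin{cases} n-\frac{1}{2}(t_{m}+t_{m-3}+m+3),&\alpha_m\leq n<\beta_{m};\\ \frac{1}{2}(t_{m-1}+t_{m-2}+4t_{m-3}-m-5),&\beta_{m}\leq n<\gamma_m;\\ n-\frac{1}{2}(t_{m-1}+3t_{m-2}+m+3),&\gamma_m\leq n<\theta_m;\\ \frac{1}{2}(2t_{m-1}+t_{m-2}+3t_{m-3}-m-6),&\theta_m\leq n<\alpha_{m+1}, \end{cases} \end{equation*} where $\alpha_m=2t_{m-1}$, $\beta_m=t_{m}+2t_{m-3}-1$, $\gamma_m=2t_{m}-t_{m-1}$ and $\theta_m=\frac{3t_{m}+t_{m-2}-3}{2}$.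
   Context: The Tribonacci sequence $\mathbb{T}=x_1x_2x_3\cdots$ is the fixed point (infinite word starting with $a$) of the substitution $\sigma(a)=ab$, $\sigma(b)=ac$, $\sigma(c)=a$ over $\{a,b,c\}$. For $n\ge1$, $\mathbb{T}[1,n]=x_1\cdots x_n$ is its prefix of length $n$. The Tribonacci numbers are $t_m=|\sigma^m(a)|$ for $m\ge0$, with $t_{-2}=0$, $t_{-1}=1$; thus $t_0=1,t_1=2,t_2=4$ and $t_m=t_{m-1}+t_{m-2}+t_{m-3}$. *)

(* Defs.v *)
From mathcomp Require Import all_boot all_order all_algebra.
Set Implicit Arguments. Unset Strict Implicit. Unset Printing Implicit Defensive.
Import Order.TTheory GRing.Theory Num.Theory.

Definition la : nat := 0.
Definition lb : nat := 1.
Definition lc : nat := 2.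

Definition sigma_letter (x : nat) : seq nat :=
  if x == la then [:: la; lb] else if x == lb then [:: la; lc] else [:: la].
Definition sigma (w : seq nat) : seq nat := flatten (map sigma_letter w).

Definition sigma_pow_a (m : nat) : seq nat := iter m sigma [:: la].

(* The Tribonacci word, 0-indexed: trib_letter i = x_{i+1}.  Since
   sigma^k(a) is a prefix of sigma^{k+1}(a) and |sigma^(i+1)(a)| > i, this is
   the i-th letter (from 0) of the fixed point of sigma starting with a. *)
Definition trib_letter (i : nat) : nat := nth la (sigma_pow_a i.+1) i.

Definition Tprefix (n : nat) : seq nat := mkseq trib_letter n.

Definition factors (s : seq nat) : seq (seq nat) :=
  [seq take j (drop i s) | i <- iota 0 (size s).+1, j <- iota 0 (size s).+1].

(* A(n): number of distinct nonempty words w such that ww is a factor of T[1,n].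
   (Any such w is itself a factor of T[1,n], so it suffices to range over factors.) *)
Definition A (n : nat) : nat :=
  size (undup [seq w <- factors (Tprefix n) |
                 (w != [::]) && infix (w ++ w) (Tprefix n)]).

(* Shifted Tribonacci numbers: tt k = t_{k-2}; tt 0 = t_{-2} = 0, tt 1 = t_{-1} = 1,
   tt 2 = t_0 = 1, and tt (k+3) = tt (k+2) + tt (k+1) + tt k. *)
Fixpoint tt (k : nat) : nat :=
  match k with
  | 0 => 0
  | 1 => 1
  | 2 => 1
  | (((k0 as a).+1 as b).+1 as c).+1 => tt c + tt b + tt a
  end.

(* Tribonacci numbers t_j for integer j >= -2 (value 0 below -2, never used). *)
Definition trib (j : int) : nat :=
  match (j + 2)%R with
  | Posz k => tt k
  | Negz _ => 0
  end.

Local Open Scope ring_scope.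

Definition tq (j : int) : rat := (trib j)%:R.

Definition alpha (m : nat) : rat := 2 * tq (m%:Z - 1).
Definition beta (m : nat) : rat := tq m%:Z + 2 * tq (m%:Z - 3) - 1.
Definition gamma (m : nat) : rat := 2 * tq m%:Z - tq (m%:Z - 1).
Definition theta (m : nat) : rat := (3 * tq m%:Z + tq (m%:Z - 2) - 3) / 2.

(* Main.v *)
Require Import Defs.
From mathcomp Require Import all_boot all_order all_algebra.
From mathcomp Require Import zify lra.
Set Implicit Arguments. Unset Strict Implicit. Unset Printing Implicit Defensive.
Import Order.TTheory GRing.Theory Num.Theory.

(** Since [T = sigma T] and every block [sigma x] starts with [a], a maximal
    region where [T] agrees with its shift by [p], if it is at least [p - 1]
    letters long, is the [sigma]-image of a shorter such region, extended by one
    letter.  Iterating down to empty agreements with shift 1, every square of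
    [T] has as root a rotation of [sigma^k(x)] for a letter [x], and lies in the
    agreement region grown from an occurrence of [x]; that region exceeds the
    period by [e_k' = t_0 + ... + t_(k'-1)], with [k' = k-3, k-2, k-1] for
    [x = a, b, c].  As [sigma^(k+1)(c) = sigma^k(a)], the first occurrences come
    from the letters [x_1 = a], [x_2 = b] and [x_4 = c]; they end at pairwise
    distinct positions, which fill the intervals [alpha_m, beta_m] and
    [gamma_m, theta_m] for [m >= 3].  Distinct rotations give distinct roots
    because [sigma] preserves primitivity. *)

(** * The Tribonacci word as the limit of the words [sigma_pow_a k] *)

Local Notation T := trib_letter.

Lemma sigma_cat s t : sigma (s ++ t) = sigma s ++ sigma t.
Proof. by rewrite /sigma map_cat flatten_cat. Qed.

Lemma sigma_cons x s : sigma (x :: s) = sigma_letter x ++ sigma s.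
Proof. by []. Qed.

Lemma sigma_letter_cons x : sigma_letter x = la :: behead (sigma_letter x).
Proof. by rewrite /sigma_letter; case: ifP => // _; case: ifP. Qed.

Lemma size_sigma_letter x : 0 < size (sigma_letter x) <= 2.
Proof. by rewrite /sigma_letter; case: ifP => // _; case: ifP. Qed.

Lemma sigma_pow_aS_cat k :
  exists x w, sigma_pow_a k.+1 = sigma_pow_a k ++ x :: w.
Proof.
elim: k => [|k [x [w IH]]]; first by exists lb, [::].
exists la, (behead (sigma_letter x) ++ sigma w).
rewrite [LHS](_ : _ = sigma (sigma_pow_a k.+1)) // {1}IH sigma_cat sigma_cons.
by rewrite {1}sigma_letter_cons.
Qed.

Lemma ltn_size_sigma_pow_a k : k < size (sigma_pow_a k).
Proof.
elim: k => [//|k IH]; have [x [w ->]] := sigma_pow_aS_cat k.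
by rewrite size_cat /=; lia.
Qed.

Lemma sigma_pow_a_cat k d : exists w, sigma_pow_a (k + d) = sigma_pow_a k ++ w.
Proof.
elim: d => [|d [w IH]]; first by exists [::]; rewrite addn0 cats0.
have [x [v E]] := sigma_pow_aS_cat (k + d).
by exists (w ++ x :: v); rewrite addnS E IH catA.
Qed.

Lemma nth_sigma_pow_a k i : i < size (sigma_pow_a k) ->
  nth la (sigma_pow_a k) i = T i.
Proof.
move=> lik; have li := ltn_size_sigma_pow_a i.+1; rewrite /trib_letter.
have [le|lt] := leqP k i.+1.
  have [w E] := sigma_pow_a_cat k (i.+1 - k); rewrite subnKC // in E.
  by rewrite E nth_cat lik.
have [w E] := sigma_pow_a_cat i.+1 (k - i.+1); rewrite subnKC ?(ltnW lt) // in E.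
by rewrite E nth_cat ifT //; lia.
Qed.

Lemma take_sigma_pow_a k n : n <= size (sigma_pow_a k) ->
  take n (sigma_pow_a k) = Tprefix n.
Proof.
move=> le; apply: (@eq_from_nth _ la); first by rewrite size_takel ?size_mkseq.
move=> i; rewrite size_takel // => lt.
by rewrite nth_take // nth_mkseq // nth_sigma_pow_a //; lia.
Qed.

(** * Decomposition of [T] into blocks *)

(* [phi u] is where the block [sigma (T u)] starts in [T = sigma T]. *)
Definition phi (u : nat) : nat := size (sigma (Tprefix u)).

Lemma sigma_Tprefix u : sigma (Tprefix u) = Tprefix (phi u).
Proof.
have lu := ltn_size_sigma_pow_a u.
have E : sigma_pow_a u.+1 = sigma (Tprefix u) ++ sigma (drop u (sigma_pow_a u)).
  by rewrite -sigma_cat -(@take_sigma_pow_a u u) ?cat_take_drop //; lia.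
rewrite -(@take_sigma_pow_a u.+1 (phi u)); first by rewrite E take_size_cat.
by rewrite E size_cat leq_addr.
Qed.

Lemma phi0 : phi 0 = 0. Proof. by []. Qed.

Lemma Tprefix_phiS u : Tprefix (phi u.+1) = Tprefix (phi u) ++ sigma_letter (T u).
Proof.
by rewrite -!sigma_Tprefix /Tprefix mkseqS -cats1 sigma_cat sigma_cons cats0.
Qed.

Lemma phiS u : phi u.+1 = phi u + size (sigma_letter (T u)).
Proof.
by have := congr1 size (Tprefix_phiS u); rewrite size_cat !size_mkseq.
Qed.

Lemma T_block u j : j < size (sigma_letter (T u)) ->
  T (phi u + j) = nth la (sigma_letter (T u)) j.
Proof.
move=> lj; have := congr1 (fun s => nth la s (phi u + j)) (Tprefix_phiS u).
rewrite nth_mkseq ?phiS ?ltn_add2l // => ->.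
by rewrite nth_cat size_mkseq ltnNge leq_addr addKn.
Qed.

Lemma T_phi u : T (phi u) = 0.
Proof.
have := @T_block u 0; rewrite addn0 => -> //.
  by rewrite sigma_letter_cons.
by have /andP[] := size_sigma_letter (T u).
Qed.

Lemma phi_ltS u : phi u < phi u.+1 <= phi u + 2.
Proof. by rewrite phiS; have := size_sigma_letter (T u); lia. Qed.

Lemma phi_cover i : exists u j, i = phi u + j /\ j < size (sigma_letter (T u)).
Proof.
elim: i => [|i [u [j [-> lj]]]].
  by exists 0, 0; have /andP[] := size_sigma_letter (T 0).
have [lt|ge] := ltnP j.+1 (size (sigma_letter (T u))).
  by exists u, j.+1; rewrite addnS.
exists u.+1, 0; have := size_sigma_letter (T u.+1); rewrite phiS; lia.
Qed.

Lemma T_lt3 i : T i < 3.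
Proof.
have [u [j [-> lj]]] := phi_cover i; rewrite T_block //; move: lj.
rewrite /sigma_letter; case: ifP => [_|_]; last case: ifP => _.
all: by case: j => [|[|[|j]]].
Qed.

Lemma size_blockE u : size (sigma_letter (T u)) = if T u == 2 then 1 else 2.
Proof. by have := T_lt3 u; rewrite /sigma_letter; case: (T u) => [|[|[|]]]. Qed.

Lemma phiSE u : phi u.+1 = phi u + (if T u == 2 then 1 else 2).
Proof. by rewrite phiS size_blockE. Qed.

(* For the letter [c] this reads the first letter of the next block. *)
Lemma T_phiS u : T (phi u).+1 = (T u).+1 %% 3.
Proof.
have := @T_block u 1; have := phiSE u; have := T_phi u.+1; have := T_lt3 u.
rewrite addn1 /sigma_letter; case: (T u) => [|[|[|]]] //= _.
- by move=> _ _ ->.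
- by move=> _ _ ->.
- by rewrite addn1 => /[swap] ->.
Qed.

Lemma T_eq0 i : T i = 0 -> exists u, i = phi u.
Proof.
have [u [j [-> lj]]] := phi_cover i; rewrite T_block //; move: lj.
have := T_lt3 u; rewrite /sigma_letter; case: (T u) => [|[|[|]]] //= _.
all: by case: j => [|[|]] //= _ _; exists u; rewrite addn0.
Qed.

Lemma T_neq0 i : T i <> 0 -> exists u, i = (phi u).+1 /\ T u <> 2.
Proof.
have [u [[|j] [-> lj]]] := phi_cover i; first by rewrite addn0 T_phi.
move: lj; rewrite size_blockE => lj _; exists u.
by case: eqP lj => [|E] //; case: j => // _; rewrite addn1.
Qed.

Lemma T_pred_nz i : T i.+1 <> 0 -> T i = 0.
Proof. by move=> /T_neq0[u [[->] _]]; rewrite T_phi. Qed.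

Lemma T_no_cc i : T i = 2 -> T i.+1 <> 2.
Proof.
move=> Ti; case: (@T_neq0 i) => [|u [Ei Tu]]; first by rewrite Ti.
rewrite (_ : i.+1 = phi u.+1) ?T_phi // phiSE Ei.
by case: eqP => // _; rewrite addn2.
Qed.

Lemma leq_phi : {homo phi : u v / u <= v}.
Proof.
move=> u v; elim: v => [|v IH]; first by rewrite leqn0 => /eqP->.
rewrite leq_eqVlt ltnS => /predU1P[->//|/IH].
by have := phi_ltS v; lia.
Qed.

Lemma ltn_phi : {homo phi : u v / u < v}.
Proof. by move=> u v /leq_phi; have := phi_ltS u; lia. Qed.

Lemma leq_phi_add u d : phi u + d <= phi (u + d).
Proof.
elim: d => [|d IH]; first by rewrite !addn0.
by rewrite !addnS; have := phi_ltS (u + d); lia.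
Qed.

(** As [cc] never occurs, one of two consecutive blocks has two letters. *)
Lemma phi_add2 u : phi u + 3 <= phi u.+2.
Proof.
rewrite phiSE (phiSE u); case: eqP => [E|_]; case: eqP => [E'|_]; try lia.
by have := T_no_cc E; rewrite E'.
Qed.

(** * Agreements between two positions and their images under [sigma] *)

Definition agree u v L := forall j, j < L -> T (u + j) = T (v + j).

Lemma agreeW u v L L' : L' <= L -> agree u v L -> agree u v L'.
Proof. by move=> le H j lj; apply: H; lia. Qed.

(** Equal letters have blocks of equal length; the additive form avoids truncated subtraction. *)
Lemma phi_agree u v L : agree u v L -> phi (u + L) + phi v = phi (v + L) + phi u.
Proof.
elim: L => [|L IH] H; first by rewrite !addn0 addnC.
have {}IH := IH (agreeW (leqnSn L) H).
by rewrite !addnS !phiSE (H L) //; lia.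
Qed.

(** The images agree block by block; the extra letter is the [a] that opens the next block on either
    side. *)
Lemma agree_phi u v L : agree u v L ->
  agree (phi u) (phi v) (phi (u + L) - phi u).+1.
Proof.
elim: L => [|L IH] H.
  by rewrite addn0 subnn => -[|//] _; rewrite !addn0 !T_phi.
have HL := agreeW (leqnSn L) H; have {}IH := IH HL.
have E := phi_agree HL; have E' := phi_agree H.
have le := @leq_phi u (u + L) (leq_addr _ _).
have le' := @leq_phi v (v + L) (leq_addr _ _).
move=> j; rewrite addnS ltnS => lj.
have [/IH//|gj] := ltnP j (phi (u + L) - phi u).+1.
have [ej|nj] := eqVneq j (phi (u + L.+1) - phi u).
  rewrite (_ : phi u + j = phi (u + L.+1)); last first.
    by rewrite ej; move: le; rewrite addnS; have := phi_ltS (u + L); lia.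
  rewrite (_ : phi v + j = phi (v + L.+1)) ?T_phi //.
  by move: E' ej le; rewrite !addnS; have := phi_ltS (u + L); lia.
rewrite addnS in nj; have := phi_ltS (u + L) => lS.
rewrite (_ : phi u + j = (phi (u + L)).+1); last by lia.
rewrite (_ : phi v + j = (phi (v + L)).+1); last by lia.
by rewrite !T_phiS H.
Qed.

Definition phik k u := iter k phi u.

(* Each step of [phi] extends a maximal agreement by exactly one letter, the
   common first letter of the two differing blocks: [Rk k u] is where the
   agreement that is empty at [u] ends after [k] steps. *)
Definition Rk k u := iter k (fun r => (phi r).+1) u.

Lemma phik_Rk k u : phik k u <= Rk k u.
Proof. by elim: k => //= k /leq_phi; lia. Qed.

Lemma leq_phik k : {homo phik k : u v / u <= v}.
Proof. by elim: k => // k IH u v /IH; apply: leq_phi. Qed.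

Lemma phik0 k : phik k 0 = 0.
Proof. by elim: k => //= k ->. Qed.

Lemma agree_phik k u v L : agree u v L ->
  agree (phik k u) (phik k v) (phik k (u + L) - phik k u).
Proof.
elim: k => [|k IH] H; first by rewrite /= addKn.
have /agree_phi := IH H; rewrite subnKC ?leq_phik ?leq_addr //.
exact: agreeW.
Qed.

Lemma agree_Rk k u v : agree (phik k u) (phik k v) (Rk k u - phik k u).
Proof.
elim: k => [|k IH]; first by rewrite /= subnn.
have := agree_phi IH; rewrite subnKC ?phik_Rk //.
by have := leq_phi (phik_Rk k u) => le; apply: agreeW; rewrite /= subSn.
Qed.

Definition ek k := Rk k 0.

(** The agreement between [0] and [phik k v] makes the blocks added at each step equally long, so
    the overshoot does not depend on [v]. *)
Lemma Rk_shift k v : Rk k v = phik k v + ek k.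
Proof.
elim: k => [|k IH]; first by rewrite addn0.
have := @agree_Rk k 0 v; rewrite phik0 subn0 -/(ek k) => /phi_agree.
by rewrite /= IH add0n phi0 addn0 /ek /= => E; lia.
Qed.

(* [len k x = |sigma^k(x)|] *)
Definition len k x :=
  if x == 0 then tt k.+2 else if x == 1 then tt k.+1 + tt k else tt k.+1.

Lemma ttS k : tt k.+3 = tt k.+2 + tt k.+1 + tt k.
Proof. by []. Qed.

(** Peel off the innermost [phi]: the block of [T u] consists of an [a] and, unless [T u] is [c], of
    the letter [T (phi u).+1], and the lengths of their images add up. *)
Lemma phikS k u : phik k u.+1 = phik k u + len k (T u).
Proof.
elim: k u => [|k IH] u.
  by have := T_lt3 u; rewrite /len; case: (T u) => [|[|[|]]] //= _; rewrite addn1.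
rewrite /phik !iterSr -!/(phik k _) phiSE.
have := T_phiS u; have := T_lt3 u.
case: (T u) => [|[|[|]]] //= _ E; rewrite ?addn1 ?addn2 IH.
all: by rewrite ?[phik _ (phi u).+1]IH ?E T_phi /len /=; lia.
Qed.

Lemma phik1 k : phik k 1 = tt k.+2.
Proof. by rewrite phikS phik0. Qed.

Lemma ekS k : ek k.+1 = ek k + tt k.+2.
Proof. by rewrite -phik1 addnC -Rk_shift /ek /Rk iterSr. Qed.

(** Source of the halves in the theorem: twice the sum [t_0 + ... + t_(k-1)] is a sum of Tribonacci
    numbers up to a constant. *)
Lemma ekE k : 2 * ek k + 3 = tt k.+1 + tt k.+3.
Proof. by elim: k => // k IH; move: IH; rewrite ekS !ttS; lia. Qed.

(** * Aperiodicity and desubstitution of maximal agreements *)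

Lemma T_phiS_inj u v : T (phi u).+1 = T (phi v).+1 -> T u = T v.
Proof.
rewrite !T_phiS; have := T_lt3 u; have := T_lt3 v.
by case: (T u) (T v) => [|[|[|]]] // [|[|[|]]].
Qed.

Lemma first_mismatch u v L : T (u + L) <> T (v + L) ->
  exists l, [/\ l <= L, agree u v l & T (u + l) <> T (v + l)].
Proof.
move=> neq.
have ex : exists l, T (u + l) != T (v + l) by exists L; apply/eqP.
have [l /eqP ml minl] := find_ex_minn ex.
exists l; split=> //; first by apply/minl/eqP.
by move=> j lj; apply/eqP; apply: contraLR lj => /minl; rewrite -leqNgt.
Qed.

Lemma mismatch_uniq u v L L' : agree u v L -> T (u + L) <> T (v + L) ->
  agree u v L' -> T (u + L') <> T (v + L') -> L = L'.
Proof.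
move=> H N H' N'; case: (ltngtP L L') => // [/H'|/H] //.
Qed.

Lemma ltn_phi_gap u q p : 1 < p -> phi u + p = phi (u + q) -> q < p.
Proof.
move=> p1 E; case: q E => [|[|q]] E; [lia..|].
have := phi_add2 u; have := leq_phi_add u.+2 q.
by rewrite (_ : u.+2 + q = u + q.+2); lia.
Qed.

(** [T] is not eventually periodic. If shifting the block start [phi s] by [p > 1] lands on an [a],
    hence on a block start, the shift comes from a smaller shift of block indices, whose mismatch
    lifts; the shift 1 is settled directly. *)
Lemma mismatch_exists p s : 0 < p -> exists d, T (s + d) <> T (s + p + d).
Proof.
elim/ltn_ind: p s => p IH s p0.
have les : s <= phi s by have := leq_phi_add 0 s; rewrite phi0.
suff [j [le neq]] : exists j, s <= j /\ T j <> T (j + p).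
  by exists (j - s); rewrite addnAC subnKC.
have [E|N] := eqVneq (T (phi s + p)) 0; last first.
  by exists (phi s); split=> //; rewrite T_phi => E; rewrite -E eqxx in N.
have [p1|p1] := leqP p 1.
  have ? : p = 1 by lia.
  subst p; rewrite addn1 T_phiS in E.
  have Ts : T s = 2 by move: E; have := T_lt3 s; case: (T s) => [|[|[|]]].
  have Es : phi s.+1 = (phi s).+1 by rewrite phiSE Ts addn1.
  exists (phi s).+1; split; first by lia.
  rewrite addn1 -Es T_phi T_phiS; have := T_no_cc Ts; have := T_lt3 s.+1.
  by case: (T s.+1) => [|[|[|]]].
have [v Ev] := T_eq0 E.
have lev : s <= v by rewrite leqNgt; apply/negP => /ltn_phi; lia.
have Eq : phi s + p = phi (s + (v - s)) by rewrite subnKC.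
have q0 : 0 < v - s.
  by rewrite subn_gt0 ltn_neqAle lev andbT; apply/eqP => ?; subst v; lia.
have [d /first_mismatch [l [_ Hl Nl]]] := IH _ (ltn_phi_gap p1 Eq) s q0.
exists (phi (s + l)).+1; split.
  by have := leq_phi_add s l; lia.
have := phi_agree Hl; rewrite -Eq => El.
rewrite (_ : _ + p = (phi (s + (v - s) + l)).+1); last by lia.
by move=> /T_phiS_inj.
Qed.

Lemma left_extension p i : exists s, [/\ s <= i, agree s (s + p) (i - s)
  & s = 0 \/ T s.-1 <> T (s + p).-1].
Proof.
elim: i => [|i [s [le H B]]]; first by exists 0; split=> //; left.
have [E|N] := eqVneq (T i) (T (i + p)); last first.
  by exists i.+1; rewrite subnn; split=> //; right; rewrite addSn /=; apply/eqP.
exists s; split=> //; first exact: leqW.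
move=> j; rewrite subSn // ltnS leq_eqVlt => /predU1P[->|/H//].
by rewrite addnAC subnKC.
Qed.

(** Here [l] is the length of the agreement, so the factor of period [p] has length [l + p]. *)
Definition run p s l := [/\ agree s (s + p) l, T (s + l) <> T (s + p + l)
  & s = 0 \/ T s.-1 <> T (s + p).-1].

(** A [b] or [c] is always preceded by [a], so a region starting with one could be extended to the
    left. *)
Lemma run_start p s l : 0 < l -> run p s l -> T s = 0.
Proof.
move=> l0 [H _ [->|B]]; first exact: (T_phi 0).
case: s H B => [|s] H B; first exact: (T_phi 0).
have := H 0 l0; rewrite !addn0 addSn => E.
have [//|/eqP N] := eqVneq (T s.+1) 0; case: B.
by rewrite addSn /= (T_pred_nz N) T_pred_nz // -E.
Qed.

(* Blocks begin with [a], and distinct blocks end with distinct letters, so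
   a run starts at a block boundary and is the image of a shorter run. *)
Lemma run_descent p s l : 0 < p <= l.+1 -> 0 < l -> run p s l ->
  exists u q l', [/\ 0 < q <= l'.+1, l' < l, run q u l'
    & [/\ s = phi u, s + p = phi (u + q) & s + l = (phi (u + l')).+1]].
Proof.
move=> /andP[p0 pl] l0 R; have Ts := run_start l0 R; case: R => H N B.
have [u Eu] := T_eq0 Ts.
have [v Ev] : exists v, s + p = phi v.
  by apply: T_eq0; have := H 0 l0; rewrite !addn0 Ts.
have lev : u < v by rewrite ltnNge; apply/negP => /leq_phi; lia.
have [q Eq] : exists q, v = u + q by exists (v - u); rewrite subnKC // ltnW.
subst v; have q0 : 0 < q by lia.
have [d /first_mismatch [l' [_ Hl Nl]]] := mismatch_exists u q0.
have El : s + l = (phi (u + l')).+1.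
  have Ep := phi_agree Hl; have le := @leq_phi u (u + l') (leq_addr _ _).
  have HH := agree_phi Hl; rewrite -Ev -Eu in HH.
  suff -> : l = (phi (u + l') - s).+1 by lia.
  apply: mismatch_uniq H N HH _.
  rewrite (_ : s + _ = (phi (u + l')).+1); last by lia.
  rewrite (_ : s + p + _ = (phi (u + q + l')).+1); last by lia.
  by move=> /T_phiS_inj.
exists u, q, l'; split=> //.
(* Two consecutive blocks have at least three letters, so [l'.+2 <= q] would force [p > l.+1]. *)
- rewrite q0 leqNgt; apply/negP => lt.
  have := @leq_phi (u + l').+2 (u + q); have := phi_add2 (u + l'); lia.
- by have := leq_phi_add u l'; lia.
- split=> //; case: u Eu Ev {lev Hl Nl El} => [|u] Eu Ev; first by left.
  right; rewrite addSn /= => E; case: B => [E0|].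
    by have := phi_ltS u; lia.
  apply; rewrite Ev Eu addSn.
  have key w w' : T w = T w' -> T (phi w.+1).-1 = T (phi w'.+1).-1.
    move=> Ew; rewrite !phiSE Ew; case: eqP => _; first by rewrite !addn1 !T_phi.
    by rewrite !addn2 !T_phiS Ew.
  exact: key.
Qed.

(** The bound [p <= l.+1], weaker than the [p <= l] that a square gives, survives the descent and
    leaves only [p = 1] at [l = 0]. *)
Lemma run_desubstitution l p s : 0 < p <= l.+1 -> run p s l ->
  exists k u, [/\ s = phik k u, s + p = phik k u.+1 & s + l = Rk k u].
Proof.
elim/ltn_ind: l p s => -[|l] IH p s Hp R.
  by exists 0, s; rewrite addn0; split=> //=; lia.
have [//|u [q [l' [Hq ll' R' [-> -> ->]]]]] := run_descent Hp _ R.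
have [k [w [-> -> ->]]] := IH _ ll' _ _ Hq R'.
by exists k.+1, w.
Qed.

Lemma square_desubstitution p i : 0 < p -> agree i (i + p) p ->
  exists k u, [/\ phik k u <= i, phik k u + p = phik k u.+1 & i + p <= Rk k u].
Proof.
move=> p0 H; have [s [le Hs B]] := left_extension p i.
have [d /first_mismatch [l [_ Hl Nl]]] := mismatch_exists i p0.
have pl : p <= l by rewrite leqNgt; apply/negP => /H.
have R : run p s (i - s + l).
  split=> //.
    move=> j lj; have [/Hs//|ge] := ltnP j (i - s).
    rewrite (_ : s + j = i + (j - (i - s))); last by lia.
    by rewrite (_ : s + p + j = i + p + (j - (i - s))) ?Hl //; lia.
  have -> : s + (i - s + l) = i + l by lia.
  by have -> : s + p + (i - s + l) = i + p + l by lia.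
have [|k [u [E1 E2 E3]]] := run_desubstitution _ R; first by lia.
by exists k, u; split; [lia..|]; rewrite -E3; lia.
Qed.

(** * Regions grown from each letter, and roots as rotations *)

Lemma phik_iterSr k u : phik k.+1 u = phik k (phi u).
Proof. exact: iterSr. Qed.

Lemma Rk_iterSr k u : Rk k.+1 u = Rk k (phi u).+1.
Proof. exact: iterSr. Qed.

(** After one step the agreement ends at [(phi u).+1]. For a [c] this is the next block boundary,
    and the other [k] steps overshoot by [ek k]; for a [b] it is a [c], and for an [a] it is a [b],
    which costs one or two further steps in [Rk_b] and [Rk_a]. *)
Lemma Rk_c k u : T u = 2 -> Rk k.+1 u = phik k.+1 u.+1 + ek k.
Proof. by move=> Tu; rewrite Rk_iterSr Rk_shift phik_iterSr phiSE Tu addn1. Qed.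

Lemma Rk_b k u : T u = 1 -> Rk k.+2 u = phik k.+2 u.+1 + ek k.
Proof.
move=> Tu; rewrite Rk_iterSr Rk_c; last by rewrite T_phiS Tu.
by rewrite [in RHS]phik_iterSr phiSE Tu addn2.
Qed.

Lemma Rk_a k u : T u = 0 -> Rk k.+3 u = phik k.+3 u.+1 + ek k.
Proof.
move=> Tu; rewrite Rk_iterSr Rk_b; last by rewrite T_phiS Tu.
by rewrite [in RHS]phik_iterSr phiSE Tu addn2.
Qed.

Definition slice s p := mkseq (fun j => T (s + j)) p.

Lemma slice0 p : slice 0 p = Tprefix p. Proof. by []. Qed.

Lemma eq_slice s t p : agree s t p <-> slice s p = slice t p.
Proof.
split=> [H|E j lj]; last first.
  by have := congr1 (fun x => nth 0 x j) E; rewrite !nth_mkseq.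
apply: (@eq_from_nth _ 0); rewrite ?size_mkseq // => j lj.
by rewrite !nth_mkseq // H.
Qed.

Lemma agree_mod P p l j : 0 < p -> agree P (P + p) l -> j < l + p ->
  T (P + j) = T (P + j %% p).
Proof.
move=> p0 H; elim/ltn_ind: j => j IH lj.
have [lt|ge] := ltnP j p; first by rewrite modn_small.
have -> : P + j = P + p + (j - p) by lia.
rewrite -H; last by lia.
rewrite IH; [|lia|lia].
by rewrite -[in RHS](subnK ge) modnDr.
Qed.

Lemma slice_rot P p l i : 0 < p -> agree P (P + p) l -> i <= l ->
  slice (P + i) p = rot (i %% p) (slice P p).
Proof.
move=> p0 H il; have ltp := ltn_pmod i p0.
apply: (@eq_from_nth _ 0); first by rewrite size_rot !size_mkseq.
move=> j; rewrite size_mkseq => lj; rewrite nth_mkseq // -addnA.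
rewrite (agree_mod p0 H); last by lia.
rewrite /rot nth_cat size_drop size_mkseq nth_drop.
rewrite -modnDml; move: (i %% p) ltp => r ltp; case: ltnP => lt.
  by rewrite modn_small ?nth_mkseq //; lia.
rewrite nth_take; last by lia.
rewrite nth_mkseq; last by lia.
congr (T (P + _)); rewrite -[in LHS](@subnK p (r + j)); last by lia.
by rewrite modnDr modn_small; lia.
Qed.

(** * First occurrences of squares *)

Lemma T1 : T 1 = 1. Proof. by []. Qed.
Lemma phi3 : phi 3 = 6. Proof. by []. Qed.

(** The index [6 = phi 3] is where the image of the first [c], at index 3, starts. *)
Lemma phik6 k : phik k 6 = 2 * tt k.+3 + tt k.+2 + tt k.+1.
Proof. by rewrite -phi3 -phik_iterSr 2!phikS phik1 /len /=; lia. Qed.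

Lemma tt_gt0 k : 0 < tt k.+1.
Proof. by elim/ltn_ind: k => -[|[|k]] IH //; rewrite ttS; have := IH k.+1; lia. Qed.

(* [canon n w]: the square [w ++ w] occurs in [T] for the first time ending at
   length [n].  Its root is a rotation of [sigma^k(a)], of length [tt k.+2], or
   of [sigma^k.+2(b)]. *)
Inductive canon : nat -> seq nat -> Prop :=
| canon_early k r : r <= ek k ->
    canon (2 * tt k.+4.+1 + r) (rot r (slice 0 (tt k.+4.+1)))
| canon_late k r : r < tt k.+2 -> (forall k', k = k'.+3 -> ek k' < r) ->
    canon (phik k 6 + 2 * tt k.+2 + r) (rot r (slice 0 (tt k.+2)))
| canon_b k r : r <= ek k ->
    canon (tt k.+4 + 2 * (tt k.+3 + tt k.+2) + r)
          (rot r (slice (tt k.+4) (tt k.+3 + tt k.+2))).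

Lemma slice_phik k u v : T u = T v ->
  slice (phik k u) (len k (T u)) = slice (phik k v) (len k (T u)).
Proof.
move=> E; apply/eq_slice; have H : agree u v 1 by case=> // _; rewrite !addn0.
by have := agree_phik (k := k) H; rewrite addn1 phikS addKn.
Qed.

(** Handles both origins of a rotation of [sigma^k(a)]: regions grown from a [c] give [6 <= u], and
    those grown from an [a] give a small [r], whose square already occurs near the start of [T]. *)
Lemma canon_a k r u : T u = 0 -> r < tt k.+2 ->
  (6 <= u \/ exists2 k', k = k'.+3 & r <= ek k') ->
  exists2 n, n <= phik k u + 2 * tt k.+2 + r
    & canon n (rot r (slice (phik k u) (tt k.+2))).
Proof.
move=> Tu lr B.
have -> : slice (phik k u) (tt k.+2) = slice 0 (tt k.+2).
  by have := @slice_phik k u 0; rewrite Tu phik0 => ->.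
have [[k' Ek rk']|late] : (exists2 k', k = k'.+3 & r <= ek k') \/
    (forall k', k = k'.+3 -> ek k' < r).
  case: k {lr B} => [|[|[|k]]]; try by right.
  have [le|gt] := leqP r (ek k); first by left; exists k.
  by right=> k' [<-].
  by subst k; exists (2 * tt k'.+4.+1 + r); [lia|apply: canon_early].
exists (phik k 6 + 2 * tt k.+2 + r); last exact: canon_late.
case: B => [/(@leq_phik k)|[k' Ek]]; first by lia.
by have := late _ Ek; lia.
Qed.

Lemma square_canon p i : 0 < p -> agree i (i + p) p ->
  exists2 n, n <= i + 2 * p & canon n (slice i p).
Proof.
move=> p0 H; have [k [u [le Ep leR]]] := square_desubstitution p0 H.
have Hu : agree (phik k u) (phik k u + p) (Rk k u - phik k u).
  by rewrite Ep; apply: agree_Rk.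
have Elen : p = len k (T u) by move: Ep; rewrite phikS; lia.
have [d Ed] : exists d, i = phik k u + d by exists (i - phik k u); rewrite subnKC.
(* The offset [d] can reach [p] when the region contains a cube; only its residue affects the
   root. *)
have Es : slice i p = rot (d %% p) (slice (phik k u) p).
  by rewrite Ed (slice_rot p0 Hu) //; lia.
have rd : d %% p <= d := leq_mod _ _.
have rp : d %% p < p := ltn_pmod _ p0.
rewrite Es; have := T_lt3 u; case Tu: (T u) => [|[|[|]]] // _.
- have {}Elen : p = tt k.+2 by rewrite Elen Tu.
  rewrite Elen in rp rd *.
  (* For [k < 3] the region grown from an [a] is too short for a square. *)
  have [k' Ek] : exists k', k = k'.+3.
    case: (k) leR Ep Ed => [|[|[|k']]] leR Ep Ed; last by exists k'.
    + by move: leR Ep Ed => /=; lia.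
    + by move: leR Ep Ed; rewrite /= phiSE Tu /=; lia.
    + have E1 : phi u.+1 = (phi u).+2 by rewrite phiSE Tu addn2.
      have E2 := phiSE (phi u).+1; rewrite T_phiS Tu /= in E2.
      by move: leR Ep Ed; rewrite /= E1 E2; lia.
  have led : d <= ek k'.
    by move: leR; rewrite Ek Rk_a // -Ek -Ep; lia.
  have [|n le' C] := @canon_a k (d %% tt k.+2) u Tu rp.
    by right; exists k' => //; lia.
  by exists n => //; lia.
- have [k' Ek] : exists k', k = k'.+2.
    case: (k) leR Ep Ed => [|[|k']] leR Ep Ed; last by exists k'.
    + by move: leR Ep Ed => /=; lia.
    + by move: leR Ep Ed; rewrite /= phiSE Tu /=; lia.
  have led : d <= ek k'.
    by move: leR; rewrite Ek Rk_b // -Ek -Ep; lia.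
  have u1 : 1 <= u by case: (u) Tu.
  have := @leq_phik k _ _ u1; rewrite phik1 => lek.
  have -> : slice (phik k u) p = slice (tt k.+2) p.
    by have := @slice_phik k u 1; rewrite phik1 Elen Tu => ->.
  have {}Elen : p = tt k'.+3 + tt k'.+2 by rewrite Elen Tu Ek.
  exists (tt k'.+4 + 2 * p + d %% p); first by rewrite {1}Ek in lek; lia.
  by rewrite Ek Elen; apply: canon_b; rewrite -Elen; lia.
- have [k' Ek] : exists k', k = k'.+1.
    by case: (k) leR Ep Ed => [|k'] leR Ep Ed; [move: leR Ep Ed => /=; lia|exists k'].
  have {}Elen : p = tt k'.+2 by rewrite Elen Tu Ek.
  have u3 : 3 <= u by case: (u) Tu => [|[|[|]]].
  have := leq_phi u3; rewrite phi3 => u6.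
  (* The [c] at [u] is traded for the [a] at [phi u], its image. *)
  rewrite Ek phik_iterSr Elen in le Ed rp rd *.
  have [|n le' C] := @canon_a k' (d %% tt k'.+2) (phi u) (T_phi u) rp.
    by left.
  by exists n => //; lia.
Qed.

(** The region grown from a [c] is long enough to contain the squares of all rotations of its
    root. *)
Lemma leq_tt_ek k : tt k.+2 <= (ek k).+1.
Proof.
have := ekE k; case: k => [|[|k]] //; rewrite 3!ttS.
by have := tt_gt0 k.+1; lia.
Qed.

Lemma canon_sound n w : canon n w -> exists s p,
  [/\ 0 < p, w = slice s p, agree s (s + p) p & n = s + 2 * p].
Proof.
(* Converse of the desubstitution: a region at least [r] longer than two periods holds the square of
   the rotation by [r]. *)
have key k u r p : 0 < p -> phik k u + p = phik k u.+1 ->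
    phik k u + p + r <= Rk k u -> r < p ->
    agree (phik k u + r) (phik k u + r + p) p
      /\ slice (phik k u + r) p = rot r (slice (phik k u) p).
  move=> p0 Ep le rp; have H := @agree_Rk k u u.+1; rewrite -Ep in H.
  split; last by rewrite (slice_rot p0 H) ?modn_small //; lia.
  move=> j lj; rewrite -addnA H; last by lia.
  by congr T; lia.
case=> {n w} [k r le|k r lt _|k r le].
- have [||||H E] := @key k.+3 0 r (tt k.+4.+1).
  + exact: tt_gt0.
  + by rewrite phik1 phik0.
  + by rewrite phik0 Rk_a // phik1; lia.
  + by have := ekE k; rewrite !ttS; lia.
  exists r, (tt k.+4.+1); rewrite phik0 in H E; split=> //; [exact: tt_gt0|lia].
- have E6 : T 6 = 0 by rewrite -phi3 T_phi.
  have E3 : phik k.+1 3 = phik k 6 by rewrite phik_iterSr phi3.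
  have [||||H E] := @key k.+1 3 r (tt k.+2).
  + exact: tt_gt0.
  + by rewrite [RHS]phikS.
  + have E4 : phik k.+1 4 = phik k.+1 3 + tt k.+2 := phikS k.+1 3.
    by rewrite Rk_c // E4; have := leq_tt_ek k; lia.
  + by [].
  rewrite E3 in H E.
  exists (phik k 6 + r), (tt k.+2); split=> //; [exact: tt_gt0| |lia].
  rewrite E; have := @slice_phik k 6 0; rewrite E6 phik0 => -> //.
- have [||||H E] := @key k.+2 1 r (tt k.+3 + tt k.+2).
  + by have := tt_gt0 k.+1; lia.
  + by rewrite [RHS]phikS.
  + have E2 : phik k.+2 2 = phik k.+2 1 + (tt k.+3 + tt k.+2) := phikS k.+2 1.
    by rewrite Rk_b // E2; lia.
  + by have := ekE k; rewrite !ttS; lia.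
  exists (phik k.+2 1 + r), (tt k.+3 + tt k.+2); rewrite E phik1; split=> //.
  + by have := tt_gt0 k.+1; lia.
  + by move: H; rewrite phik1.
  + by lia.
Qed.

(** * Primitivity, expressed as the absence of nontrivial rotations fixing the word *)

Definition rot_free (w : seq nat) := forall i, 0 < i < size w -> rot i w <> w.

Lemma rot_free_inj w r r' : rot_free w -> r < size w -> r' < size w ->
  rot r w = rot r' w -> r = r'.
Proof.
move=> H; wlog lt : r r' / r <= r' => [IH lr lr' E|].
  by have [/IH->//|/ltnW /IH ->//] := leqP r r'.
move=> lr lr'; rewrite -{1}(subnKC lt) rotD ?subnKC //; last exact: ltnW.
move=> /rot_inj/esym E; apply/eqP; rewrite eqn_leq lt andTb leqNgt.
by apply/negP => lt'; apply: H E; lia.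
Qed.

Lemma sigma_neq_cons x s t : sigma t <> x.+1 :: s.
Proof. by case: t => // y t; rewrite sigma_cons sigma_letter_cons. Qed.

Lemma sigma_inj s t : all (fun x => x < 3) s -> all (fun x => x < 3) t ->
  sigma s = sigma t -> s = t.
Proof.
elim: s t => [|x s IH] [|y t] //.
- by move=> _ _; rewrite sigma_cons sigma_letter_cons.
- by move=> _ _; rewrite sigma_cons sigma_letter_cons.
move=> /=/andP[lx ls] /andP[ly lt]; rewrite !sigma_cons.
case: x y lx ly => [|[|[|]]] // [|[|[|]]] // _ _ /= [].
- by move/(IH _ ls lt) ->.
- by move/esym/sigma_neq_cons.
- by move/(IH _ ls lt) ->.
- by move/esym/sigma_neq_cons.
- by move/sigma_neq_cons.
- by move/sigma_neq_cons.
- by move/(IH _ ls lt) ->.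
Qed.

(** The letter [a] occurs in a block only as its first letter. *)
Lemma sigma_cut w i : i < size (sigma w) -> nth la (sigma w) i = la ->
  exists2 j, j < size w & i = size (sigma (take j w)).
Proof.
elim: w i => // x w IH i; have [->|i0] := posnP i; first by exists 0.
rewrite sigma_cons size_cat nth_cat => li; case: ltnP => [lt|ge].
  move: lt; rewrite /sigma_letter.
  by case: ifP => _; [|case: ifP => _]; case: i i0 {li} => [|[|]].
move=> /IH [|j lj Ej]; first by lia.
by exists j.+1 => //=; rewrite sigma_cons size_cat -Ej subnKC.
Qed.

(* A rotation of [sigma w] that starts with [a] cuts at a block boundary. *)
Lemma rot_free_sigma w : all (fun x => x < 3) w -> rot_free w ->
  rot_free (sigma w).
Proof.
move=> lw H i /andP[i0 li] E.
have [|j lj Ej] := sigma_cut li.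
  (* A rotation fixing [sigma w] puts its first letter, an [a], at position [i]. *)
  have := congr1 (fun s => nth la s 0) E.
  rewrite /rot nth_cat size_drop subn_gt0 li nth_drop addn0 => ->.
  by case: (w) li => // x w' _; rewrite sigma_cons sigma_letter_cons.
case: (@H j).
  by rewrite lj andbT lt0n; apply: contraTneq i0 => E0; rewrite Ej E0 take0.
apply: sigma_inj => //.
  by rewrite /rot all_cat andbC -all_cat cat_take_drop.
rewrite -E Ej /rot sigma_cat.
have -> : sigma w = sigma (take j w) ++ sigma (drop j w).
  by rewrite -sigma_cat cat_take_drop.
by rewrite drop_size_cat // take_size_cat.
Qed.

Lemma slice_cat s p q : slice s (p + q) = slice s p ++ slice (s + p) q.
Proof.
elim: q => [|q IH]; first by rewrite addn0 cats0.
by rewrite addnS /slice !mkseqS -rcons_cat -/(slice s _) IH addnA.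
Qed.

Lemma sigma_slice u d : sigma (slice u d) = slice (phi u) (phi (u + d) - phi u).
Proof.
have le := @leq_phi u (u + d) (leq_addr _ _).
have := sigma_Tprefix (u + d).
rewrite -slice0 slice_cat sigma_cat add0n slice0 sigma_Tprefix.
rewrite -[in Tprefix (phi (u + d))](subnKC le) -[RHS]slice0 slice_cat add0n.
by move/eqP; rewrite slice0 eqseq_cat // eqxx => /eqP.
Qed.

Lemma rot_free_slice_phik k u d : rot_free (slice u d) ->
  rot_free (slice (phik k u) (phik k (u + d) - phik k u)).
Proof.
elim: k => [|k IH] H; first by rewrite addKn.
have := IH H => /rot_free_sigma; rewrite sigma_slice subnKC; last first.
  by rewrite leq_phik ?leq_addr.
by apply; apply/(all_nthP 0) => i; rewrite size_mkseq => li; rewrite nth_mkseq ?T_lt3.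
Qed.

Lemma rot_free_slice k u : rot_free (slice (phik k u) (len k (T u))).
Proof.
have := @rot_free_slice_phik k u 1; rewrite addn1 phikS addKn; apply.
by move=> i; rewrite size_mkseq; lia.
Qed.

(** * Each root has only one canonical end *)

Lemma leq_tt k k' : k <= k' -> tt k.+1 <= tt k'.+1.
Proof.
elim: k' => [|k' IH]; first by rewrite leqn0 => /eqP->.
rewrite leq_eqVlt ltnS => /predU1P[->//|/IH]; case: k' {IH} => // k'.
by rewrite ttS; lia.
Qed.

Lemma ltn_tt k k' : k < k' -> tt k.+2 < tt k'.+2.
Proof.
case: k' => // k'; rewrite ltnS -ltnS => /leq_tt le; rewrite ttS.
by have := tt_gt0 k'; lia.
Qed.

Lemma tt_inj k k' : tt k.+2 = tt k'.+2 -> k = k'.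
Proof. by case: (ltngtP k k') => // /ltn_tt; lia. Qed.

(** The length [tt k.+3 + tt k.+2] lies strictly between consecutive Tribonacci numbers, so the
    length of the root tells its letter and its level; primitivity then determines the rotation. *)
Lemma canon_fun_l n n' w : canon n w -> canon n' w -> n = n'.
Proof.
(* The early and late cases share their roots; this test on [r] separates them exactly as the side
   condition of [canon_late] does. *)
pose E k r := if (3 <= k) && (r <= ek (k - 3)) then 2 * tt k.+2 + r
              else phik k 6 + 2 * tt k.+2 + r.
have key m v : canon m v ->
    (exists k r, [/\ r < tt k.+2, v = rot r (slice 0 (tt k.+2)) & m = E k r]) \/
    (exists k r, [/\ r < tt k.+3 + tt k.+2,
      v = rot r (slice (tt k.+4) (tt k.+3 + tt k.+2)) &
      m = tt k.+4 + 2 * (tt k.+3 + tt k.+2) + r]).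
  case=> [k r le|k r lt H|k r le].
  - left; exists k.+3, r; rewrite /E -[k.+3]addn3 addnK leq_addl le addn3; split=> //.
    by have := ekE k; rewrite !ttS; lia.
  - left; exists k, r; rewrite /E; split=> //.
    case: ifP => // /andP[k3 le]; have := H (k - 3); lia.
  - right; exists k, r; split=> //.
    by have := ekE k; rewrite !ttS; lia.
have sz s p r : size (rot r (slice s p)) = p by rewrite size_rot size_mkseq.
move=> /key[] [k [r [lr -> ->]]] /key[] [k' [r' [lr' Ew ->]]].
- have := congr1 size Ew; rewrite !sz => /tt_inj Ek; subst k'.
  suff -> : r = r' by [].
  apply: rot_free_inj Ew; rewrite ?size_mkseq //.
  by have := @rot_free_slice k 0; rewrite phik0.
- have := congr1 size Ew; rewrite !sz => Es.
  have [le|gt] := leqP k k'.+1.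
    by have := @leq_tt k.+1 k'.+2 le; have := tt_gt0 k'.+1; lia.
  by have := @leq_tt k'.+3 k.+1 gt; have := tt_gt0 k'; rewrite [tt k'.+4]ttS; lia.
- have := congr1 size Ew; rewrite !sz => Es.
  have [le|gt] := leqP k' k.+1.
    by have := @leq_tt k'.+1 k.+2 le; have := tt_gt0 k.+1; lia.
  by have := @leq_tt k.+3 k'.+1 gt; have := tt_gt0 k; rewrite [tt k.+4]ttS; lia.
- have := congr1 size Ew; rewrite !sz => Es.
  have Ek : k = k'.
    case: (ltngtP k k') => // lt; have := ltn_tt lt.
      by have := @ltn_tt k.+1 k'.+1 lt; lia.
    by have := @ltn_tt k'.+1 k.+1 lt; lia.
  subst k'; suff -> : r = r' by [].
  apply: rot_free_inj Ew; rewrite ?size_mkseq //.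
  by have := @rot_free_slice k.+2 1; rewrite phik1 T1.
Qed.

(** * Where the first occurrences end *)

(* With [m = j + 3]: [al j = alpha_m], [be j = beta_m + 1], [ga j = gamma_m], and
   [theta_m = ga j + ek j]. *)
Definition al j := 2 * tt j.+4.
Definition be j := tt j.+4.+1 + 2 * tt j.+2.
Definition ga j := tt j.+4 + 2 * (tt j.+3 + tt j.+2).

(* End of the square of [sigma^j(a) = sigma^(j+1)(c)] grown from [x_4 = c]. *)
Definition late j := phik j 6 + 2 * tt j.+2.

(* The canonical root whose square ends at [n], for [al j <= n < al j.+1]. *)
Definition canon_word j n :=
  if n < be j then
    if (0 < j) && (n <= al j + ek j.-1) then rot (n - al j) (slice 0 (tt j.+4))
    else rot (n - late j) (slice 0 (tt j.+2))
  else rot (n - ga j) (slice (tt j.+4) (tt j.+3 + tt j.+2)).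

Lemma block_order j :
  [/\ al j < be j, be j < ga j, ga j + ek j < al j.+1 &
   0 < j -> al j + ek j.-1 < be j].
Proof.
case: j => [//|j]; rewrite /al /be /ga; have := ekE j.+1; have := ekE j.
have := tt_gt0 j; have := tt_gt0 j.+1; rewrite !ttS /= => *; split; lia.
Qed.

(** The early squares end from [al j] to [al j + ek j.-1]. The late ones, once the rotations already
    found early are dropped, take over at the very next position and last until [be j]; for [j = 0]
    they start at [al j]. *)
Lemma lateE j :
  [/\ late j + tt j.+2 = be j,
      j = 0 -> late j = al j,
      0 < j -> j < 3 -> late j = al j + ek j.-1 + 1 &
      forall k, j = k.+3 -> late j + ek k = al j + ek j.-1].
Proof.
rewrite /late phik6 /al /be; split.
- by rewrite !ttS; lia.
- by move=> ->.
- by case: j => [|[|[|]]].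
- by move=> k ->; rewrite -[k.+3.-1]/(k.+2) !ekS !ttS; lia.
Qed.

Lemma canonP j n : al j <= n ->
  n < be j \/ ga j <= n <= ga j + ek j -> canon n (canon_word j n).
Proof.
move=> le H; rewrite /canon_word; case: ltnP H => [lt _|ge [|/andP[g1 g2]]].
- case: ifP => [/andP[j0 le']|/negP early].
    case: j j0 le {lt} le' => // j _ le le'.
    have E : n = 2 * tt j.+4.+1 + (n - al j.+1) by rewrite /al in le *; lia.
    by rewrite {1}E; apply: canon_early; move: le' => /=; lia.
  have [E1 E2 E3 E4] := lateE j; set s := late j in E1 E2 E3 E4 *.
  have les : s <= n.
    case: (posnP j) => [/E2|j0]; first by lia.
    have {}early : al j + ek j.-1 < n.
      by rewrite ltnNge; apply/negP => h; apply: early; rewrite j0.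
    have [/E3|j3] := ltnP j 3; first by lia.
    by have := E4 (j - 3); lia.
  rewrite {1}(_ : n = s + (n - s)); last by lia.
  apply: canon_late; first by lia.
  move=> k Ek; have := E4 _ Ek.
  have : al j + ek j.-1 < n; last by lia.
  by rewrite ltnNge; apply/negP => h; apply: early; rewrite Ek in h *.
- by lia.
- rewrite {1}(_ : n = ga j + (n - ga j)); last by lia.
  by apply: canon_b; lia.
Qed.

(** As [canon_word] is a function, at most one first occurrence ends at each [n]; with [canonP], the
    two ranges are exactly where one does. *)
Lemma canon_inv n w : canon n w -> exists j,
  [/\ al j <= n, n < al j.+1, n < be j \/ ga j <= n <= ga j + ek j
    & w = canon_word j n].
Proof.
case=> {n w} [k r le|k r lt H|k r le].
- exists k.+1; have [o1 o2 o3 o4] := block_order k.+1.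
  have := o4 isT; rewrite -/(al k.+1) /= => o; split; [lia..| |].
    by left; lia.
  by rewrite /canon_word /= !ifT; [|lia|lia]; rewrite addKn.
- exists k; have [o1 o2 o3 o4] := block_order k.
  have [E1 E2 E3 E4] := lateE k; set s := late k in E1 E2 E3 E4 *.
  have early : 0 < k -> al k + ek k.-1 < s + r.
    move=> k0; have [/(E3 k0)|k3] := ltnP k 3; first by lia.
    by have := E4 (k - 3); have := H (k - 3); lia.
  rewrite -/(late k) -/s; have : al k <= s + r by case: (posnP k) => [/E2|/early]; lia.
  split; [lia..| |]; first by left; lia.
  rewrite /canon_word -/s ifT; last by lia.
  rewrite ifF ?addKn //; apply/negP => /andP[/early]; lia.
- exists k; have [o1 o2 o3 o4] := block_order k; rewrite -/(ga k); split; [lia..| |].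
    by right; lia.
  by rewrite /canon_word ifF ?addKn //; lia.
Qed.

Lemma al_uniq j j' n : al j <= n -> n < al j.+1 -> al j' <= n -> n < al j'.+1 ->
  j = j'.
Proof.
rewrite /al => *; case: (ltngtP j j') => // lt.
- by have := @leq_tt j.+4 j'.+3 lt; lia.
- by have := @leq_tt j'.+4 j.+3 lt; lia.
Qed.

(** * Counting the squares of a prefix *)

Definition squares n :=
  [seq w <- factors (Tprefix n) | (w != [::]) && infix (w ++ w) (Tprefix n)].

(** An occurrence in the prefix need not be the canonical one, but [square_canon] supplies a
    canonical end that is no later. *)
Lemma mem_squares n w :
  reflect (exists2 n', n' <= n & canon n' w) (w \in squares n).
Proof.
apply: (iffP idP).
  rewrite mem_filter => /andP[/andP[w0 /infixP H] _].
  have [s [s' E]] : exists s s' : seq nat, Tprefix n = s ++ (w ++ w) ++ s' := H.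
  have Es := congr1 size E; rewrite size_mkseq !size_cat in Es.
  have nw j : j < size w + size w -> nth 0 (w ++ w) j = T (size s + j).
    move=> lj; have := congr1 (fun x => nth 0 x (size s + j)) E.
    rewrite nth_mkseq; last by lia.
    by rewrite nth_cat ltnNge leq_addr addKn nth_cat size_cat lj /= => ->.
  have Ew : w = slice (size s) (size w).
    apply: (@eq_from_nth _ 0); rewrite ?size_mkseq // => j lj.
    by rewrite nth_mkseq // -nw ?nth_cat ?lj //; lia.
  have [||n' le C] := @square_canon (size w) (size s).
  - by case: (w) w0.
  - move=> j lj; rewrite -addnA -[RHS]nw -?[LHS]nw; [|lia..].
    by rewrite !nth_cat lj ltnNge leq_addr addKn.
  exists n'; first by lia.
  by rewrite Ew.
move=> [n' le /canon_sound[s [p [p0 Ew H En]]]].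
have En' : n = s + (p + (p + (n - n'))) by lia.
have E : Tprefix n = Tprefix s ++ w ++ w ++ slice (s + p + p) (n - n').
  rewrite En' -[LHS]slice0 !slice_cat add0n slice0 Ew.
  by rewrite -(proj1 (eq_slice _ _ _) H) -En'.
have sw : size w = p by rewrite Ew size_mkseq.
rewrite mem_filter -size_eq0 sw -lt0n p0 /=; apply/andP; split.
  by apply/infixP; exists (Tprefix s), (slice (s + p + p) (n - n')); rewrite E !catA.
apply/allpairsPdep; exists s, p.
rewrite !mem_iota size_mkseq; split; [lia..|].
by rewrite E drop_size_cat ?size_mkseq // take_size_cat.
Qed.

Lemma A_stay n : (forall w, ~ canon n.+1 w) -> A n.+1 = A n.
Proof.
move=> H; apply/perm_size/uniq_perm; rewrite ?undup_uniq // => w.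
rewrite !mem_undup; apply/mem_squares/mem_squares => -[n' le C].
  exists n' => //; rewrite -ltnS ltn_neqAle le andbT.
  by apply/eqP => E; subst n'; apply: (H w).
by exists n' => //; apply: leqW.
Qed.

Lemma A_new n w : canon n.+1 w -> (forall w', canon n.+1 w' -> w' = w) ->
  A n.+1 = (A n).+1.
Proof.
move=> C U; rewrite -[(A n).+1]/(size (w :: undup (squares n))).
apply/perm_size/uniq_perm; rewrite ?cons_uniq ?undup_uniq ?andbT //.
  rewrite mem_undup; apply/negP => /mem_squares[n' le C'].
  by have := canon_fun_l C C'; lia.
move=> v; rewrite in_cons !mem_undup; apply/idP/predU1P => [/mem_squares|].
  move=> [n' le C']; move: le; rewrite leq_eqVlt => /predU1P[E|lt].
    by left; apply: U; rewrite -E.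
  by right; apply/mem_squares; exists n'.
move=> [->|/mem_squares[n' le C']]; apply/mem_squares; first by exists n.+1.
by exists n' => //; apply: leqW.
Qed.

Lemma A_step j n : al j <= n.+1 < al j.+1 ->
  A n.+1 = A n + ((n.+1 < be j) || (ga j <= n.+1 <= ga j + ek j)).
Proof.
move=> /andP[l1 l2]; case: (boolP (_ || _)) => [H|N].
  rewrite addn1; have /orP H' := H.
  apply: A_new (canonP l1 H') _ => w' /canon_inv[j' [l1' l2' _ ->]].
  by rewrite (al_uniq l1 l2 l1' l2').
rewrite addn0; apply: A_stay => w /canon_inv[j' [l1' l2' H _]].
by move: N; rewrite (al_uniq l1 l2 l1' l2') => /negP; apply; apply/orP.
Qed.

Lemma A_linear c lo hi n : (forall i, lo <= i < hi -> A i.+1 = A i + c) ->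
  lo <= n <= hi -> A n = A lo + c * (n - lo).
Proof.
move=> H; elim: n => [|n IH]; first by case: lo {H} => // _; rewrite muln0 addn0.
rewrite leq_eqVlt => /andP[/predU1P[->|lt] le]; first by rewrite subnn muln0 addn0.
rewrite H ?IH; nia.
Qed.

(** The growth ranges are anchored one position early, at [(al j).-1] and [(ga j).-1], because
    [A_step] describes the increment on arriving at [n.+1]. *)
Lemma A_block j n :
  [/\ (al j).-1 <= n < be j -> A n = A (al j).-1 + (n - (al j).-1),
      (be j).-1 <= n < ga j -> A n = A (al j).-1 + (be j - al j),
      (ga j).-1 <= n <= ga j + ek j ->
        A n = A (al j).-1 + (be j - al j) + (n - (ga j).-1) &
      ga j + ek j <= n < al j.+1 ->
        A n = A (al j).-1 + (be j - al j) + (ek j).+1].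
Proof.
have [o1 o2 o3 _] := block_order j; have a0 := tt_gt0 j.+3.
have a0' : 0 < al j by rewrite /al; lia.
have S1 i : (al j).-1 <= i <= (be j).-1 -> A i = A (al j).-1 + 1 * (i - (al j).-1).
  by apply: A_linear => k Hk; rewrite (@A_step j); lia.
have S2 i : (be j).-1 <= i <= (ga j).-1 -> A i = A (be j).-1 + 0 * (i - (be j).-1).
  by apply: A_linear => k Hk; rewrite (@A_step j); lia.
have S3 i : (ga j).-1 <= i <= ga j + ek j -> A i = A (ga j).-1 + 1 * (i - (ga j).-1).
  by apply: A_linear => k Hk; rewrite (@A_step j); lia.
have S4 i : ga j + ek j <= i <= (al j.+1).-1 ->
    A i = A (ga j + ek j) + 0 * (i - (ga j + ek j)).
  by apply: A_linear => k Hk; rewrite (@A_step j); lia.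
have := S1 (be j).-1; have := S2 (ga j).-1; have := S3 (ga j + ek j).
move=> H3 H2 H1; split=> Hn.
- by rewrite S1; lia.
- by rewrite S2; lia.
- by rewrite S3; lia.
- by rewrite S4; lia.
Qed.

Lemma A_small n : n <= 7 -> A n = 0.
Proof.
elim: n => // n IH le; rewrite A_stay; first by apply: IH; lia.
move=> w /canon_inv[j [l1 _ _ _]]; move: l1; rewrite /al.
by have := @leq_tt 3 j.+3 isT; rewrite [tt 4]/=; lia.
Qed.

(** This is the fourth formula of the theorem for [m = j + 2], the constant value reached just
    before the block [j] begins. *)
Lemma A_block_start j :
  2 * A (al j).-1 + j + 8 = 2 * tt j.+3 + tt j.+2 + 3 * tt j.+1.
Proof.
elim: j => [|j IH]; first by rewrite A_small.
have [o1 o2 o3 _] := block_order j.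
have [_ _ _ ->] := A_block j (al j.+1).-1; last by lia.
by move: IH o1; rewrite /al /be !ttS; have := ekE j; rewrite !ttS; lia.
Qed.

(** * Translation to the rational formulas *)

Local Open Scope ring_scope.

Lemma tqE (j : int) k : j + 2 = k%:Z -> tq j = (tt k)%:R.
Proof. by rewrite /tq /trib => ->. Qed.

Lemma eq_natr (a b : nat) : a = b -> a%:R = b%:R :> rat.
Proof. by move=> ->. Qed.

Lemma alphaE j : alpha j.+3 = (al j)%:R.
Proof. by rewrite /alpha (@tqE _ j.+4) ?natrM //; lia. Qed.

Lemma betaE j : beta j.+3 = (be j).-1%:R.
Proof.
have E : (be j).-1.+1 = be j by rewrite prednK // /be; have := tt_gt0 j.+1; lia.
rewrite /beta (@tqE _ j.+4.+1) ?(@tqE _ j.+2); [|lia|lia].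
by have := eq_natr E; rewrite /be -natr1 !(natrM, natrD); lra.
Qed.

Lemma gammaE j : gamma j.+3 = (ga j)%:R.
Proof.
rewrite /gamma (@tqE _ j.+4.+1) ?(@tqE _ j.+4); [|lia|lia].
have E : (2 * tt j.+4.+1 = ga j + tt j.+4)%N by rewrite /ga [tt j.+4]ttS !ttS; lia.
by have := eq_natr E; rewrite !(natrM, natrD); lra.
Qed.

(** By [ekE] the numerator of [theta] is even. *)
Lemma thetaE j : theta j.+3 = (ga j + ek j)%:R.
Proof.
rewrite /theta (@tqE _ j.+4.+1) ?(@tqE _ j.+3); [|lia|lia].
have E : (3 * tt j.+4.+1 + tt j.+3 = 2 * (ga j + ek j) + 3)%N.
  by rewrite /ga; have := ekE j; rewrite !ttS; lia.
by have := eq_natr E; rewrite !(natrM, natrD); lra.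
Qed.

Theorem theoremA :
  (forall n : nat, (1 <= n <= 7)%N -> A n = 0%N) /\
  A 8 = 1%N /\ A 9 = 1%N /\
  (forall n : nat, (10 <= n <= 13)%N -> A n = 2%N) /\
  (forall n m : nat, (14 <= n)%N ->
     alpha m <= n%:R < alpha m.+1 ->
     (4 <= m)%N /\
     (alpha m <= n%:R < beta m ->
        (A n)%:R = n%:R - (tq m%:Z + tq (m%:Z - 3) + m%:R + 3) / 2 :> rat) /\
     (beta m <= n%:R < gamma m ->
        (A n)%:R = (tq (m%:Z - 1) + tq (m%:Z - 2) + 4 * tq (m%:Z - 3) - m%:R - 5) / 2 :> rat) /\
     (gamma m <= n%:R < theta m ->
        (A n)%:R = n%:R - (tq (m%:Z - 1) + 3 * tq (m%:Z - 2) + m%:R + 3) / 2 :> rat) /\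
     (theta m <= n%:R < alpha m.+1 ->
        (A n)%:R = (2 * tq (m%:Z - 1) + tq (m%:Z - 2) + 3 * tq (m%:Z - 3) - m%:R - 6) / 2 :> rat)).
Proof.
split; first by move=> n /andP[_]; apply: A_small.
have A7 : A (al 0).-1 = 0%N by apply: A_small.
(* The block [j = 0] is the range [8 <= n < 14]. *)
split; first by have [-> //] := A_block 0 8; rewrite A7.
split; first by have [_ -> //] := A_block 0 9; rewrite A7.
split; first by move=> n Hn; have [_ _ _ ->] := A_block 0 n; rewrite ?A7.
move=> n m n14 Hm.
(* For [m <= 3] the bound [alpha m.+1] is at most [alpha 4 = 14]. *)
have m4 : (4 <= m)%N.
  rewrite leqNgt; apply/negP => lt; case/andP: Hm => _; apply/negP; rewrite -leNgt.
  rewrite /alpha (@tqE _ m.+2); last by lia.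
  rewrite -natrM ler_nat; apply: leq_trans n14.
  by case: m lt => [|[|[|[|]]]].
split=> //; case: m Hm m4 => [|[|[|j]]] // Hm _.
move: Hm; rewrite !alphaE betaE gammaE thetaE !(ler_nat, ltr_nat) => Hm.
rewrite (@tqE j.+3%:Z j.+4.+1) ?(@tqE (j.+3%:Z - 1) j.+4); [|lia..].
rewrite (@tqE (j.+3%:Z - 2) j.+3) ?(@tqE (j.+3%:Z - 3) j.+2); [|lia..].
have [B1 B2 B3 B4] := A_block j n; have S := A_block_start j.
have [o1 o2 o3 _] := block_order j.
have al0 : (0 < al j)%N by rewrite /al; have := tt_gt0 j.+3; lia.
(* All quantities are reduced to three consecutive Tribonacci numbers and [ek j], which makes the
   doubled identities below linear. *)
have alE : al j = (2 * (tt j.+3 + tt j.+2 + tt j.+1))%N by [].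
have beE : be j = (2 * tt j.+3 + 4 * tt j.+2 + tt j.+1)%N by rewrite /be !ttS; lia.
have gaE : ga j = (3 * tt j.+3 + 3 * tt j.+2 + tt j.+1)%N by rewrite /ga !ttS; lia.
have t5 : tt j.+4.+1 = (2 * tt j.+3 + 2 * tt j.+2 + tt j.+1)%N by rewrite !ttS; lia.
have t4 : tt j.+4 = (tt j.+3 + tt j.+2 + tt j.+1)%N by rewrite ttS.
have := ekE j => ekj.
split=> [Hn|].
  have E : (2 * A n + (tt j.+4.+1 + tt j.+2 + j.+3 + 3) = 2 * n)%N by rewrite B1; lia.
  by have := eq_natr E; rewrite !(natrM, natrD); lra.
split=> [Hn|].
  have E : (2 * A n + (j.+3 + 5) = tt j.+4 + tt j.+3 + 4 * tt j.+2)%N by rewrite B2; lia.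
  by have := eq_natr E; rewrite !(natrM, natrD); lra.
split=> [Hn|Hn].
  have E : (2 * A n + (tt j.+4 + 3 * tt j.+3 + j.+3 + 3) = 2 * n)%N by rewrite B3; lia.
  by have := eq_natr E; rewrite !(natrM, natrD); lra.
have E : (2 * A n + (j.+3 + 6) = 2 * tt j.+4 + tt j.+3 + 3 * tt j.+2)%N by rewrite B4; lia.
by have := eq_natr E; rewrite !(natrM, natrD); lra.
Qed.
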